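(* Let $\omega$ be a value transcendental extension of $\nu$ to $K(x)$. Take a minimal pair of definition $(a,\gamma)$ for $\omega$ and the minimal polynomial $Q(x)$ of $a$ over $K$. Then $\omega Q\notin\overline{\nu}\,\overline{K}$. For every polynomial $g(x)\in K[x]$ with $\deg g<\deg Q$, one has $\omega g=\overline{\nu}g(a)$. For every polynomial $f(x)\in K[x]$ with $Q$-expansion $f=f_0+f_1Q+\dotsc+f_rQ^r$, one has $$\omega f=\min_i\{\overline{\nu}f_i(a)+i\,\omega Q\}.$$
   Context: $(K,\nu)$ is a valued field (values written additively, $\nu 0=\infty$), $\overline{K}$ a fixed algebraic closure of $K$, and $K(x)$ the rational function field. For a valued field $(L,\nu)$, $\nu L$ denotes the value group. An extension $\omega$ of $\nu$ to $K(x)$ is value transcendental if $\dim_{\mathbb{Q}}\big((\omega K(x)/\nu K)\otimes_{\mathbb{Z}}\mathbb{Q}\big)=1$. Fix an extension $\overline{\nu}$ of $\nu$ to $\overline{K}$ and a common extension $\overline{\omega}$ of $\omega$ and $\overline{\nu}$ to $\overline{K}(x)$. For $a\in\overline{K}$ and $\gamma$ in an ordered abelian group containing $\overline{\nu}\,\overline{K}$, $\overline{\nu}_{a,\gamma}$ is the valuation on $\overline{K}(x)$ determined by $\overline{\nu}_{a,\gamma}\big(\sum_i c_i(x-a)^i\big)=\min_i\{\overline{\nu}c_i+i\gamma\}$ ($c_i\in\overline{K}$). A pair $(a,\gamma)$ with $a\in\overline{K}$, $\gamma\in\overline{\omega}\,\overline{K}(x)$ is a pair of definition for $\omega$ if $\overline{\omega}=\overline{\nu}_{a,\gamma}$;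 it is a minimal pair of definition if moreover for every $b\in\overline{K}$, $\overline{\nu}(a-b)\geq\gamma$ implies $[K(a):K]\leq[K(b):K]$. The $Q$-expansion of $f\in K[x]$ is the unique expression $f=f_0+f_1Q+\dotsc+f_rQ^r$ with $f_i\in K[x]$, $\deg f_i<\deg Q$. *)

(* Defs.v *)
From HB Require Import structures.
From mathcomp Require Import all_boot all_order all_algebra.
From mathcomp Require Import generic_quotient boolp.

Set Implicit Arguments.
Unset Strict Implicit.
Unset Printing Implicit Defensive.

Import Order.TTheory GRing.Theory.
Local Open Scope ring_scope.

(* Totally ordered abelian groups, in additive notation.  Totality is a mixin
   field because the hierarchy does not admit a new join of the total orders
   and the Z-modules beside realDomainType. *)
HB.mixin Record isOrderedAbelianGroup R of Num.POrderedZmodule R := {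
  oag_le_total : total (<=%R : rel R);
  oag_leD2l : forall x y z : R, x <= y -> z + x <= z + y
}.

#[short(type="oagType")]
HB.structure Definition OrderedAbelianGroup :=
  { R of Num.POrderedZmodule R & isOrderedAbelianGroup R }.

(* [extv G] is G with an additional element oo := [None], larger than every
   element of G and absorbing for the addition; oo is [\top] below. *)
Definition extv (G : Type) : Type := option G.
Definition fin (G : Type) (g : G) : extv G := Some g.

Section Extv.
Variable G : oagType.
Implicit Types x y z : extv G.

HB.instance Definition _ := Choice.on (extv G).

Definition extv_le x y : bool :=
  match x, y with
  | _, None => true
  | None, Some _ => false
  | Some a, Some b => a <= b
  end.

Lemma extv_le_refl : reflexive extv_le.
Proof. by case=> /=. Qed.

Lemma extv_le_anti : antisymmetric extv_le.
Proof. by case=> [a|] [b|] //= /le_anti ->. Qed.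

Lemma extv_le_trans : transitive extv_le.
Proof. by case=> [a|] [b|] [c|] //=; apply: le_trans. Qed.

HB.instance Definition _ := Order.Le_isPOrder.Build ring_display (extv G)
  extv_le_refl extv_le_anti extv_le_trans.

Lemma extv_le_total : total (<=%R : rel (extv G)).
Proof. by case=> [a|] [b|] //; apply: oag_le_total. Qed.

HB.instance Definition _ :=
  Order.POrder_isTotal.Build ring_display (extv G) extv_le_total.

Lemma extv_lex1 x : x <= None.
Proof. by case: x. Qed.

HB.instance Definition _ := Order.hasTop.Build ring_display (extv G) extv_lex1.

Definition extv_add x y : extv G :=
  match x, y with
  | Some a, Some b => Some (a + b)
  | _, _ => None
  end.

Lemma extv_addA : associative extv_add.
Proof. by case=> [a|] [b|] [c|] //=; rewrite addrA. Qed.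

Lemma extv_addC : commutative extv_add.
Proof. by case=> [a|] [b|] //=; rewrite addrC. Qed.

Lemma extv_add0 : left_id (fin 0) extv_add.
Proof. by case=> [a|] //=; rewrite add0r. Qed.

HB.instance Definition _ :=
  GRing.isNmodule.Build (extv G) extv_addA extv_addC extv_add0.

End Extv.

Notation "'oo" := (Order.top : extv _) (at level 0) : ring_scope.

Lemma fin_inj (G : Type) : injective (@fin G).
Proof. by move=> a b []. Qed.

Lemma finD (G : oagType) (a b : G) : fin (a + b) = fin a + fin b.
Proof. by []. Qed.

Record valuation (L : fieldType) (G : oagType) := Valuation {
  valuation_fun :> L -> extv G;
  val_eq_oo : forall x, valuation_fun x = 'oo <-> x = 0;
  valM : forall x y,
    valuation_fun (x * y) = valuation_fun x + valuation_fun y;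
  valD : forall x y,
    Num.min (valuation_fun x) (valuation_fun y) <= valuation_fun (x + y)
}.

Section ValueGroup.
Variables (L : fieldType) (G : oagType) (v : valuation L G).

Lemma val1 : v 1 = fin 0.
Proof.
case E : (v 1) => [g|]; last first.
  by have /eqP := (val_eq_oo v 1).1 E; rewrite oner_eq0.
have := valM v 1 1; rewrite mulr1 E => -[].
by rewrite -[LHS]addr0 => /addrI <-.
Qed.

(* vL, as a subset of G *)
Definition value_group : pred G := fun g => `[< exists x : L, v x = fin g >].

Lemma value_groupP g : reflect (exists x : L, v x = fin g) (g \in value_group).
Proof. exact: asboolP. Qed.

Lemma value_group_closed : zmod_closed value_group.
Proof.
split; first by apply/value_groupP; exists 1; exact: val1.
move=> g h /value_groupP[x vx] /value_groupP[y vy]; apply/value_groupP.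
exists (x / y); have y0 : y != 0.
  by apply/eqP => /((val_eq_oo v y).2); rewrite vy.
have := valM v (x / y) y; rewrite divfK // vx vy.
by case: (v (x / y)) => [k|] // [->]; rewrite addrK.
Qed.

HB.instance Definition _ := GRing.isZmodClosed.Build G value_group
  value_group_closed.

(* vL, as an abelian group *)
Record value_groupType :=
  ValueGroup { vg_val :> G; vg_valP : vg_val \in value_group }.

HB.instance Definition _ := [isSub for vg_val].
HB.instance Definition _ := [Choice of value_groupType by <:].
HB.instance Definition _ := [SubChoice_isSubZmodule of value_groupType by <:].

End ValueGroup.

Section ValueGroupQuotient.
Variables (L K : fieldType) (G : oagType).
Variables (w : valuation L G) (v : valuation K G).

Definition value_subgroup : pred (value_groupType w) :=
  fun g => vg_val g \in value_group v.

Lemma value_subgroup_closed : zmod_closed value_subgroup.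
Proof.
have memE g : (g \in value_subgroup) = (vg_val g \in value_group v) by [].
split=> [|g h]; rewrite !memE ?raddfB /=; [exact: rpred0|exact: rpredB].
Qed.

HB.instance Definition _ := GRing.isZmodClosed.Build (value_groupType w)
  value_subgroup value_subgroup_closed.

(* wL / vK *)
Definition value_quotient : zmodType :=
  Quotient.quot (GRing.ZmodClosed.clone _ value_subgroup _).

End ValueGroupQuotient.

Definition biadditive (M N T : zmodType) (f : M -> N -> T) : Prop :=
  (forall m, zmod_morphism (f m)) /\ (forall n, zmod_morphism (f^~ n)).

(* (T, tau) is the tensor product of M and N over the integers. *)
Definition is_tensor (M N T : zmodType) (tau : M -> N -> T) : Prop :=
  biadditive tau /\
  forall (W : zmodType) (f : M -> N -> W), biadditive f ->
    exists g : {additive T -> W}, (forall m n, g (tau m n) = f m n) /\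
      forall h : {additive T -> W}, (forall m n, h (tau m n) = f m n) ->
        h =1 g.

(* dim_Q (M \otimes_Z Q) = d, where Q acts on the tensor product through its
   second factor. *)
Definition rational_dim (M : zmodType) (d : nat) : Prop :=
  exists (V : vectType rat) (tau : M -> rat -> V),
    [/\ is_tensor tau,
        forall m q r, tau m (q * r) = q *: tau m r
      & \dim {: V} = d].

Notation "p %:F" := (@FracField.tofrac _ p) : ring_scope.

(* v is a valuation on K and w on K(x). *)
Definition extends_to_ratfun (K : fieldType) (G : oagType)
    (v : valuation K G) (w : valuation {fraction {poly K}} G) : Prop :=
  forall c : K, w (c%:P)%:F = v c.

Definition value_transcendental (K : fieldType) (G : oagType)
    (v : valuation K G) (w : valuation {fraction {poly K}} G) : Prop :=
  extends_to_ratfun v w /\ rational_dim (value_quotient w v) 1.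

Section Closure.
Variables (K Kbar : fieldType) (iota : {rmorphism K -> Kbar}) (G : oagType).

Definition extends (v : valuation K G) (vbar : valuation Kbar G) : Prop :=
  forall c : K, vbar (iota c) = v c.

(* The inclusion of K(x) in Kbar(x) maps p / q to map_poly iota p /
   map_poly iota q. *)
Definition extends_ratfun (w : valuation {fraction {poly K}} G)
    (wbar : valuation {fraction {poly Kbar}} G) : Prop :=
  forall p q : {poly K},
    wbar ((map_poly iota p)%:F / (map_poly iota q)%:F) = w (p%:F / q%:F).

(* K(a), the smallest subfield of Kbar containing K and a *)
Definition adjoin (a z : Kbar) : Prop :=
  forall S : {pred Kbar}, GRing.divring_closed S ->
    (forall c : K, iota c \in S) -> a \in S -> z \in S.

(* [K(a) : K] = n *)
Definition adjoin_deg (a : Kbar) (n : nat) : Prop :=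
  exists e : 'I_n -> Kbar, (forall i, adjoin a (e i)) /\
    forall z, adjoin a z ->
      exists! c : 'rV[K]_n, z = \sum_(i < n) iota (c 0 i) * e i.

(* A valuation on a rational function field is determined by its values on
   polynomials (see [val_ratfun_eq] below), so this says that
   wbar = vbar_{a,gamma}. *)
Definition is_val_ag (vbar : valuation Kbar G) (a : Kbar) (gamma : G)
    (wbar : valuation {fraction {poly Kbar}} G) : Prop :=
  forall (n : nat) (c : 'I_n -> Kbar),
    wbar (\sum_(i < n) c i *: ('X - a%:P) ^+ i)%:F =
      \big[Num.min/'oo]_(i < n) (vbar (c i) + fin gamma *+ i).

Definition pair_of_definition (vbar : valuation Kbar G)
    (wbar : valuation {fraction {poly Kbar}} G) (a : Kbar) (gamma : G) : Prop :=
  gamma \in value_group wbar /\ is_val_ag vbar a gamma wbar.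

Definition minimal_pair_of_definition (vbar : valuation Kbar G)
    (wbar : valuation {fraction {poly Kbar}} G) (a : Kbar) (gamma : G) : Prop :=
  pair_of_definition vbar wbar a gamma /\
  forall b : Kbar, fin gamma <= vbar (a - b) ->
    forall m n, adjoin_deg a m -> adjoin_deg b n -> (m <= n)%N.

Definition is_minpoly (a : Kbar) (Q : {poly K}) : Prop :=
  [/\ Q \is monic, root (map_poly iota Q) a
    & forall p : {poly K}, p != 0 -> root (map_poly iota p) a ->
        (size Q <= size p)%N].

End Closure.

Lemma val_ratfun_eq (K : fieldType) (G : oagType)
    (w w' : valuation {fraction {poly K}} G) :
  (forall p : {poly K}, w p%:F = w' p%:F) -> w =1 w'.
Proof.
move=> eqw f; pose n := (repr f).1; pose d := (repr f).2.
have d0 : d%:F != 0 by rewrite tofrac_eq0 denom_ratioP.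
have -> : f = n%:F / d%:F.
  apply/(mulIf d0); rewrite divfK //.
  rewrite -[f in LHS]reprK /n /d; unlock FracField.tofrac.
  rewrite -[LHS]FracField.pi_mul; apply/eqmodP.
  rewrite /= FracField.equivfE /FracField.mulf.
  rewrite !numden_Ratio ?mulf_neq0 ?oner_eq0 ?denom_ratioP //.
  by rewrite !mulr1 mulrC.
have := valM w (n%:F / d%:F) d%:F; rewrite divfK // eqw.
have := valM w' (n%:F / d%:F) d%:F; rewrite divfK // => ->; rewrite eqw.
case E : (w' d%:F) => [g|]; last first.
  by have /eqP := (val_eq_oo w' _).1 E; rewrite (negPf d0).
by case: (w _) (w' _) => [x|] [y|] // [] /addIr ->.
Qed.

(* Main.v *)
(* Value transcendence forces gamma to be torsion-free modulo nubar Kbar, and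
   omegabar(x - b) = min(nubar(a - b), gamma).  Factoring Q over Kbar, the root
   a contributes gamma, so omega Q = h + k gamma with k > 0 and h in nubar Kbar;
   hence omega Q is torsion-free modulo nubar Kbar too.  A root b of g with
   deg g < deg Q has degree less than [K(a) : K] over K, so minimality of
   (a, gamma) gives nubar(a - b) < gamma and omegabar(x - b) = nubar(a - b).
   Finally the nonzero terms of a Q-expansion have pairwise distinct values. *)
Require Import Defs.
From HB Require Import structures.
From mathcomp Require Import all_boot all_order all_algebra.
From mathcomp Require Import generic_quotient boolp.

Set Implicit Arguments.
Unset Strict Implicit.
Unset Printing Implicit Defensive.

Import Order.TTheory GRing.Theory.
(* all_boot rebinds val1 and valM. *)
Import Defs.
Local Open Scope ring_scope.

(** * Torsion-freeness of ordered groups, and finite minima *)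

Section OrderedGroup.
Variable G : oagType.
Implicit Types (g h : G) (x y z : extv G).

(** The order excludes torsion: if 0 <= g, then g <= g + n g = 0; otherwise the same applies to
    -g. *)
Lemma oag_mulrn_eq0 g n : g *+ n.+1 = 0 -> g = 0.
Proof.
have ge0 h m : 0 <= h -> 0 <= h *+ m.
  move=> h0; elim: m => [|m IHm]; first by rewrite mulr0n.
  by rewrite mulrS (le_trans h0) // -[X in X <= _]addr0; apply: oag_leD2l.
have eq0 h : 0 <= h -> h *+ n.+1 = 0 -> h = 0.
  move=> h0 hn; apply: le_anti; rewrite h0 andbT -hn mulrS.
  by rewrite -[X in X <= _]addr0; apply/oag_leD2l/ge0.
have /orP[/eq0//|g0] := oag_le_total 0 g.
move=> gn; apply: oppr_inj; rewrite oppr0; apply: eq0.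
  by rewrite -[0](addNr g) -[X in _ <= X]addr0; apply: oag_leD2l.
by rewrite mulNrn gn oppr0.
Qed.

Lemma oag_mulrn_inj n : injective (fun g : G => g *+ n.+1).
Proof.
by move=> g h /eqP; rewrite -subr_eq0 -mulrnBl => /eqP/oag_mulrn_eq0/subr0_eq.
Qed.

Lemma finMn g n : fin (g *+ n) = fin g *+ n.
Proof. by elim: n => // n IHn; rewrite !mulrS finD IHn. Qed.

Lemma oo_add x : 'oo + x = 'oo.
Proof. by []. Qed.

Lemma extv_big_min n (F : 'I_n -> extv G) :
  \big[Num.min/'oo]_(i < n) F i = 'oo \/
  exists i, \big[Num.min/'oo]_(i < n) F i = F i.
Proof.
apply: (big_ind (fun x => x = 'oo \/ exists i, x = F i)) => [|x y hx hy|i _].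
- by left.
- by case: leP.
- by right; exists i.
Qed.

End OrderedGroup.

(** * The ultrametric law and sums without cancellation *)

Section ValuationTheory.
Variables (L : fieldType) (G : oagType) (v : valuation L G).

Lemma val0 : v 0 = 'oo.
Proof. exact/val_eq_oo. Qed.

Lemma val_fin x : x != 0 -> exists g, v x = fin g.
Proof.
move=> x0; case E : (v x) => [g|]; first by exists g.
by move/val_eq_oo/eqP: E; rewrite (negPf x0).
Qed.

Lemma valX x n : v (x ^+ n) = v x *+ n.
Proof.
elim: n => [|n IHn]; first by rewrite expr0 val1.
by rewrite exprS valM IHn mulrS.
Qed.

Lemma val_prod (I : Type) (s : seq I) (F : I -> L) :
  v (\prod_(i <- s) F i) = \sum_(i <- s) v (F i).
Proof. exact: (big_morph v (valM v) (val1 v)). Qed.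

Lemma valN x : v (- x) = v x.
Proof.
have vN1 : v (- 1) = 0.
  have N10 : (- 1 : L) != 0 by rewrite oppr_eq0 oner_eq0.
  have [g vg] := val_fin N10; have := valX (- 1) 2.
  rewrite sqrrN expr1n val1 vg -finMn => -[] /esym g0.
  by rewrite (@oag_mulrn_eq0 _ g 1).
by rewrite -mulN1r valM vN1 add0r.
Qed.

Lemma valD_lt x y : v x < v y -> v (x + y) = v x.
Proof.
move=> ltxy; apply: le_anti; apply/andP; split; last first.
  by have := valD v x y; rewrite (min_idPl (ltW ltxy)).
(* From x = (x + y) - y, the value of x is at least the smaller of v (x + y) and v y, and it is
   below v y. *)
have := valD v (x + y) (- y); rewrite addrK valN.
by rewrite ge_min [v y <= _]leNgt ltxy orbF.
Qed.

Lemma valD_min x y :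
  (v x = v y -> v x = 'oo) -> v (x + y) = Num.min (v x) (v y).
Proof.
case: ltgtP => [/valD_lt//|/valD_lt|vxy /(_ vxy) vx].
  by rewrite addrC.
by rewrite [in v (_ + _)]((val_eq_oo v x).1 vx) add0r.
Qed.

(** Ties at infinity are allowed so that zero terms may occur. The value of a tail is infinity or
    that of one of its terms, so the next term can tie with it only at infinity. *)
Lemma val_sum_min n (F : 'I_n -> L) :
  (forall i j, i != j -> v (F i) = v (F j) -> v (F i) = 'oo) ->
  v (\sum_(i < n) F i) = \big[Num.min/'oo]_(i < n) v (F i).
Proof.
elim: n F => [|n IHn] F Fdist; first by rewrite !big_ord0 val0.
have IH := IHn (fun i => F (lift ord0 i)) => {IHn}.
rewrite !big_ord_recl -IH => [|i j ij]; last first.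
  by apply: Fdist; rewrite (inj_eq lift_inj).
apply: valD_min; rewrite IH => [|i j ij]; last first.
  by apply: Fdist; rewrite (inj_eq lift_inj).
case: (extv_big_min (fun i => v (F (lift ord0 i)))) => [->//|[i ->]].
exact: Fdist.
Qed.

Lemma val_div x y g h : v x = fin g -> v y = fin h -> v (x / y) = fin (g - h).
Proof.
move=> vx vy; have y0 : y != 0.
  by apply/eqP => y0; move: vy; rewrite y0 val0.
have := valM v (x / y) y; rewrite divfK // vx vy.
by case: (v (x / y)) => [k|] // [->]; rewrite addrK.
Qed.

End ValuationTheory.

Lemma tofrac_div (R : idomainType) (f : {fraction R}) :
  exists p q : R, q != 0 /\ f = p%:F / q%:F.
Proof.
elim/quotW: f => x; exists x.1, x.2.
have x2_neq0 := denom_ratioP x; split=> //.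
apply: (@mulIf _ x.2%:F); rewrite ?tofrac_eq0 // divfK ?tofrac_eq0 //.
unlock FracField.tofrac; rewrite -[LHS]FracField.pi_mul; apply/eqmodP => /=.
rewrite FracField.equivfE !numden_Ratio ?mulf_neq0 ?oner_eq0 //.
by rewrite !mulr1 mulrC.
Qed.

(** * The minimal polynomial of b and the degree of K(b) *)

Section Adjoin.
Variables (K Kbar : fieldType) (iota : {rmorphism K -> Kbar}) (b : Kbar).

Let ev : {rmorphism {poly K} -> Kbar} :=
  GRing.RMorphism.clone _ _ (horner_eval b \o map_poly iota) _.

Let evE p : (map_poly iota p).[b] = ev p. Proof. by []. Qed.

Lemma is_minpoly_exists :
  algebraicOver iota b -> exists P, is_minpoly iota b P.
Proof.
move=> [p0 p00 p0b].
pose S n := `[< exists p : {poly K},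
  [/\ p != 0, root (map_poly iota p) b & size p = n] >].
have exS : exists n, S n by exists (size p0); apply/asboolP; exists p0.
case: (ex_minnP exS) => n /asboolP[p [p_neq0 pb <-]] minp.
have lc0 : (lead_coef p)^-1 != 0 by rewrite invr_eq0 lead_coef_eq0.
exists ((lead_coef p)^-1 *: p); split.
- by rewrite monicE lead_coefZ mulVf ?lead_coef_eq0.
- by rewrite rootE map_polyZ hornerZ (rootP pb) mulr0.
- move=> q q0 qb; rewrite size_scale //; apply: minp.
  by apply/asboolP; exists q.
Qed.

Variable P : {poly K}.
Hypothesis P_min : is_minpoly iota b P.

Let P_neq0 : P != 0.
Proof. by case: P_min => /monic_neq0. Qed.

Let evP : ev P = 0.
Proof. by case: P_min => _ /rootP. Qed.

Lemma minpoly_eval_mod (p : {poly K}) :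
  (map_poly iota (p %% P)).[b] = (map_poly iota p).[b].
Proof.
by rewrite !evE [in RHS](divp_eq p P) rmorphD rmorphM evP mulr0 add0r.
Qed.

Lemma minpoly_eval_eq0 (p : {poly K}) :
  (size p < size P)%N -> (map_poly iota p).[b] = 0 -> p = 0.
Proof.
case: P_min => _ _ minP ltpP pb; apply/eqP; apply: contraLR ltpP => p0.
by rewrite -leqNgt minP //; apply/rootP.
Qed.

(** The gcd of P and p does not vanish at b, so its cofactor in P does; minimality of P then makes
    the gcd constant. Evaluating u P + v p = c at b yields the inverse. *)
Lemma minpoly_eval_inv (p : {poly K}) : (map_poly iota p).[b] != 0 ->
  exists q, (map_poly iota p).[b]^-1 = (map_poly iota q).[b].
Proof.
move=> pb; case: P_min => _ _ minP.
have /Bezout_coprimepP[[u v] /= /eqp_size] : coprimep P p.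
  have /dvdpP[h Ph] := dvdp_gcdl P p.
  have /dvdpP[k pk] := dvdp_gcdr P p.
  have gb : ev (gcdp P p) != 0.
    by apply: contraNneq pb; rewrite evE {2}pk rmorphM => ->; rewrite mulr0.
  have h_neq0 : h != 0.
    by apply: contraNneq P_neq0 => h0; rewrite Ph h0 mul0r.
  have g_neq0 : gcdp P p != 0 by rewrite gcdp_eq0 negb_and P_neq0.
  have : root (map_poly iota h) b.
    move: evP; rewrite Ph rmorphM /= => /eqP.
    by rewrite mulf_eq0 (negPf gb) orbF.
  move=> /(minP h h_neq0); rewrite {1}Ph size_mul // /coprimep.
  move: h_neq0 g_neq0; rewrite -!size_poly_gt0.
  case: (size h) (size (gcdp P p)) => [|m] [|[|n]] //= _ _.
  by rewrite !addnS ltnS ltnNge leq_addr.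
rewrite size_poly1 => /eqP/size_poly1P[c c0 uv].
exists (c^-1 *: v); apply: (mulIf pb); rewrite mulVf //.
rewrite !evE -rmorphM -scalerAl.
have -> : v * p = c%:P - u * P by rewrite -uv addrC addKr.
rewrite -mul_polyC rmorphM rmorphB [ev (u * P)]rmorphM evP mulr0 subr0.
by rewrite -rmorphM -polyCM mulVf // rmorph1.
Qed.

(** Every subfield containing K and b contains the values p(b), and these already form a subfield,
    by [minpoly_eval_inv]. Reduction modulo P bounds the degree. *)
Lemma adjoin_minpolyP z : adjoin iota b z <->
  exists2 p : {poly K}, (size p < size P)%N & z = (map_poly iota p).[b].
Proof.
split=> [zb|[p _ ->] S Sdiv Siota Sb]; last first.
  have [S1 SB SM] := GRing.divring_closedBM Sdiv.
  have S0 : 0 \in S by rewrite -(subrr 1) SB.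
  have SD x y : x \in S -> y \in S -> x + y \in S.
    by move=> xS yS; rewrite -[y]opprK SB // -sub0r SB.
  elim/poly_ind: p => [|p c IHp]; first by rewrite map_poly0 horner0.
  rewrite rmorphD rmorphM /= map_polyX map_polyC hornerMXaddC.
  by apply: SD; [apply: SM|exact: Siota].
pose S : {pred Kbar} := [pred z | `[< exists p, z = (map_poly iota p).[b] >]].
have SP y : reflect (exists p, y = (map_poly iota p).[b]) (y \in S).
  exact: asboolP.
have /SP[p ->] : z \in S.
  apply: zb => [|c|]; last 2 first.
  - by apply/SP; exists c%:P; rewrite map_polyC hornerC.
  - by apply/SP; exists 'X; rewrite map_polyX hornerX.
  split.
  - by apply/SP; exists 1; rewrite rmorph1 hornerC.
  - move=> _ _ /SP[p ->] /SP[q ->]; apply/SP; exists (p - q).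
    by rewrite !evE rmorphB.
  - move=> _ _ /SP[p ->] /SP[q ->]; apply/SP.
    have [->|qb] := eqVneq (map_poly iota q).[b] 0.
      by exists 0; rewrite invr0 mulr0 rmorph0 horner0.
    have [r ->] := minpoly_eval_inv qb; exists (p * r).
    by rewrite !evE rmorphM.
exists (p %% P); last by rewrite minpoly_eval_mod.
by rewrite ltn_modp.
Qed.

(** The powers of b below deg P form a basis. Coordinate rows are read as polynomials of size less
    than that of P, so minimality gives uniqueness. *)
Lemma adjoin_deg_minpoly : adjoin_deg iota b (size P).-1.
Proof.
have szP : (0 < size P)%N by rewrite size_poly_gt0.
have size_leE (p : {poly K}) : (size p <= (size P).-1)%N = (size p < size P)%N.
  by rewrite -ltnS prednK.
have evr (c : 'rV[K]_(size P).-1) :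
    (map_poly iota (rVpoly c)).[b] =
    \sum_(i < (size P).-1) iota (c 0 i) * b ^+ i.
  rewrite map_rVpoly (horner_coef_wide _ (size_poly _ _)).
  by apply: eq_bigr => i _; rewrite coef_rVpoly_ord mxE.
exists (fun i => b ^+ i); split=> [i S [S1 SB Sdiv] _ Sb|z].
  have [_ _ SM] := GRing.divring_closedBM (And3 S1 SB Sdiv).
  by elim: (i : nat) => [|n IHn]; rewrite ?expr0 // exprS SM.
move=> /adjoin_minpolyP[p ltpP ->]; exists (poly_rV p); split=> [|c].
  by rewrite -evr poly_rV_K // size_leE.
rewrite -evr => /eqP; rewrite -subr_eq0 !evE -rmorphB => /eqP pc.
rewrite -[RHS]rVpolyK; congr poly_rV; apply/eqP; rewrite -subr_eq0.
apply/eqP/minpoly_eval_eq0 => //; rewrite -size_leE.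
rewrite (leq_trans (size_polyD _ _)) // geq_max size_polyN size_poly andbT.
by rewrite size_leE.
Qed.

End Adjoin.

(** * Torsion modulo a value group *)

Lemma torsion_free_distinct (L : fieldType) (G : oagType) (v : valuation L G)
    (g : G) (c d : L) (i j : nat) :
  (forall n, g *+ n.+1 \notin value_group v) -> i != j ->
  v c + fin g *+ i = v d + fin g *+ j -> v c + fin g *+ i = 'oo.
Proof.
move=> gtf; wlog ltij : c d i j / (i < j)%N => [WH|_].
  move=> ij E; have [lt|lt|eq] := ltngtP i j; first exact: (WH c d i j).
    by rewrite E; apply: (WH d c j i); rewrite // eq_sym.
  by rewrite eq eqxx in ij.
have [->|/(val_fin v)[gc vc]] := eqVneq c 0; first by rewrite val0.
have [->|/(val_fin v)[gd vd]] := eqVneq d 0; first by rewrite val0 oo_add.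
(* For nonzero c and d the equation puts (j - i) g = v c - v d in the value group. Writing j as i +
   (j - i.+1).+1 shows this multiple to be positive. *)
rewrite vc vd -!finMn -!finD -(subnKC ltij) addSnnS => -[E].
have {}E : gc = gd + g *+ (j - i.+1).+1.
  by apply: (addIr (g *+ i)); rewrite E addnC mulrnDr addrA.
have /negP[] := gtf (j - i.+1)%N.
have -> : g *+ (j - i.+1).+1 = gc - gd by rewrite E [gd + _]addrC addrK.
by rewrite rpredB //; apply/value_groupP; [exists c|exists d].
Qed.

(** If no positive multiple of g were in nu K, the nonzero terms of p(z) = 0 would have distinct
    values. Their minimum would then be infinity, yet the leading term has a finite value. *)
Lemma algebraic_val_torsion (K Kbar : fieldType) (iota : {rmorphism K -> Kbar})
    (G : oagType) (nu : valuation K G) (nubar : valuation Kbar G) z g :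
  extends iota nu nubar -> algebraicOver iota z -> nubar z = fin g ->
  exists n, g *+ n.+1 \in value_group nu.
Proof.
move=> nubar_nu [p p0 /rootP pz] vz; apply: contrapT => /forallNP gtf.
have gtf' n : g *+ n.+1 \notin value_group nu by apply/negP/gtf.
have vF i : nubar ((map_poly iota p)`_i * z ^+ i) = nu p`_i + fin g *+ i.
  by rewrite coef_map valM nubar_nu valX vz.
have := val_sum_min (v := nubar)
  (F := fun i : 'I_(size p) => (map_poly iota p)`_i * z ^+ i).
rewrite -horner_coef_wide ?size_map_poly // pz val0 => /(_ _)/esym minoo.
have : nubar ((map_poly iota p)`_(size p).-1 * z ^+ (size p).-1) = 'oo.
  have lt : ((size p).-1 < size p)%N by rewrite ltn_predL size_poly_gt0.
  apply: le_anti; rewrite lex1 /= -minoo.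
    exact: (bigmin_le _ (Ordinal lt)).
  by move=> i j ij; rewrite !vF; apply: torsion_free_distinct.
rewrite vF -/(lead_coef p).
have lc0 : lead_coef p != 0 by rewrite lead_coef_eq0.
by have [h ->] := val_fin nu lc0; rewrite -finMn.
Qed.

Lemma zmod_morphismMn (U V : zmodType) (f : U -> V) x n :
  zmod_morphism f -> f (x *+ n) = f x *+ n.
Proof.
move=> fB; pose F := GRing.isZmodMorphism.Build U V f fB.
pose h : {additive U -> V} := HB.pack f F.
exact: (raddfMn h).
Qed.

Lemma rational_dim_torsion (M : zmodType) d :
  (forall m : M, exists n, m *+ n.+1 = 0) -> rational_dim M d -> d = 0%N.
Proof.
move=> Mtors [V [tau [[[tauD1 tauD2] tau_univ] _ <-]]].
have tau0 m q : tau m q = 0.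
  have [n mn] := Mtors m.
  (* Divisibility of the rationals lets the integer annihilating m move across the tensor: tau m q =
     tau ((n+1) m) (q / (n+1)) = 0. *)
  have -> : q = (q / n.+1%:R) *+ n.+1.
    by rewrite -[RHS]mulr_natr divfK ?Num.Theory.pnatr_eq0.
  have tauMn (x : M) r k : tau (x *+ k) r = tau x (r *+ k).
    by rewrite (zmod_morphismMn _ _ (tauD1 x)) (zmod_morphismMn _ _ (tauD2 r)).
  rewrite -tauMn mn -(mulr0n (0 : M)) tauMn mulr0n -(mulr0n (0 : rat)).
  by rewrite (zmod_morphismMn _ _ (tauD1 0)) mulr0n.
have biadd0 : biadditive (fun (_ : M) (_ : rat) => 0 : V).
  by split=> n x y; rewrite subr0.
(* The identity and the zero map both factor the zero pairing, so uniqueness identifies them and V =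
   0. *)
have [g [_ g_uniq]] := tau_univ _ _ biadd0.
have V0 (x : V) : x = 0.
  have -> : x = g x by apply: (g_uniq idfun).
  by rewrite -(g_uniq \0).
apply/eqP; rewrite dimv_eq0; apply/eqP/vspaceP => x.
by rewrite (V0 x) !mem0v.
Qed.

(** * Values of polynomials under a pair of definition *)

Section PairOfDefinition.
Variables (K : fieldType) (G : oagType) (v : valuation K G).
Variables (w : valuation {fraction {poly K}} G) (a : K) (gamma : G).
Hypothesis w_ag : is_val_ag v a gamma w.

Lemma val_ag_XsubC b : w ('X - b%:P)%:F = Num.min (v (a - b)) (fin gamma).
Proof.
(* These are the coefficients of x - b = (a - b) + (x - a). *)
have := w_ag (fun i : 'I_2 => if i == ord0 then a - b else 1).
rewrite !big_ord_recl !big_ord0 /= mulr0n mulr1n !addr0 val1 add0r.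
rewrite [Num.min (fin gamma) _]min_l ?lex1 // => <-; congr (w _%:F).
by rewrite expr0 expr1 alg_polyC scale1r polyCB [_ - b%:P + _]addrC addrA subrK.
Qed.

(** In the Taylor expansion at a, the minimum is attained by some v q_i + i gamma, which is the
    value of q_i b^i. *)
Lemma val_ag_value_group b : v b = fin gamma ->
  forall p, exists z, w p%:F = v z.
Proof.
move=> vb p; pose q := p \Po ('X + a%:P).
have -> : p = \sum_(i < size q) q`_i *: ('X - a%:P) ^+ i.
  by rewrite -[LHS](comp_polyXaddC_K p a) -/q comp_polyE.
rewrite w_ag.
have [->|[i ->]] :=
  extv_big_min (fun i : 'I_(size q) => v q`_i + fin gamma *+ i).
  by exists 0; rewrite val0.
by exists (q`_i * b ^+ i); rewrite valM valX vb.
Qed.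

(** Here k counts the entries z with v (a - z) > gamma, each contributing gamma; a itself is such an
    entry because v 0 is infinity. The other factors contribute v (a - z) to h. *)
Lemma val_ag_monic_split (s : seq K) :
  exists k h, [/\ h \in value_group v, a \in s -> (0 < k)%N &
    w (\prod_(z <- s) ('X - z%:P))%:F = fin (h + gamma *+ k)].
Proof.
elim: s => [|z s [k [h [hv ak ws]]]].
  exists 0%N, 0; split=> //; first exact: rpred0.
  by rewrite big_nil tofrac1 val1 addr0.
rewrite big_cons tofracM valM ws val_ag_XsubC.
case: leP => [|_].
  have [->|az] := eqVneq a z; first by rewrite subrr val0.
  have /(val_fin v)[g vaz] : a - z != 0 by rewrite subr_eq0.
  rewrite vaz => _; exists k, (g + h); split; last by rewrite -finD addrA.
    by rewrite rpredD //; apply/value_groupP; exists (a - z).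
  by rewrite inE (negPf az).
by exists k.+1, h; split=> //; rewrite -finD mulrS addrCA.
Qed.

End PairOfDefinition.

(** Each linear factor x - z has value min(v (a - z), gamma) = v (a - z), the value of its
    evaluation at a. *)
Lemma val_ag_eval (L : closedFieldType) (G : oagType) (v : valuation L G)
    (w : valuation {fraction {poly L}} G) a gamma (p : {poly L}) :
  extends_to_ratfun v w -> is_val_ag v a gamma w ->
  (forall b, root p b -> v (a - b) < fin gamma) -> w p%:F = v p.[a].
Proof.
move=> w_v w_ag; have [->|p0] := eqVneq p 0.
  by rewrite tofrac0 horner0 !val0.
have [s ps] := closed_field_poly_normal p; rewrite ps => root_lt.
rewrite hornerZ valM -mul_polyC tofracM valM w_v; congr (_ + _).
rewrite rmorph_prod val_prod horner_prod val_prod.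
rewrite !big_seq; apply: eq_bigr => z zs.
rewrite (val_ag_XsubC w_ag) hornerXsubC min_l // ltW // root_lt //.
by rewrite rootZ ?lead_coef_eq0 // root_prod_XsubC.
Qed.

(** * Torsion-freeness of gamma modulo the value group of Kbar *)

Section AlgebraicClosure.
Variables (K : fieldType) (Kbar : closedFieldType).
Variable iota : {rmorphism K -> Kbar}.
Hypothesis Kbar_algebraic : forall z : Kbar, algebraicOver iota z.
Variable G : oagType.
Variables (nu : valuation K G) (nubar : valuation Kbar G).
Variable omega : valuation {fraction {poly K}} G.
Variable omegabar : valuation {fraction {poly Kbar}} G.
Hypothesis nubar_nu : extends iota nu nubar.
Hypothesis omegabar_omega : extends_ratfun iota omega omegabar.

Lemma extends_ratfun_poly p : omega p%:F = omegabar (map_poly iota p)%:F.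
Proof.
by have := omegabar_omega p 1; rewrite rmorph1 !tofrac1 !divr1.
Qed.

(** An (n+1)-th root of c in Kbar has value g, since G is torsion-free. *)
Lemma value_group_div_closed g n :
  g *+ n.+1 \in value_group nubar -> g \in value_group nubar.
Proof.
move=> /value_groupP[c vc].
have /closed_rootP[b] : size ('X^(n.+1) - c%:P : {poly Kbar}) != 1%N.
  by rewrite size_XnsubC.
rewrite rootE !hornerE subr_eq0 => /eqP bc.
apply/value_groupP; exists b.
have := valX nubar b n.+1; rewrite bc vc.
case: (nubar b) => [h|]; last by rewrite [RHS]mulrS.
by rewrite -finMn => -[/oag_mulrn_inj ->].
Qed.

(* Otherwise [gamma] itself lies in the divisible group nubar Kbar, so that
   omegabar Kbar(x) = nubar Kbar and omega K(x) is torsion over nu K. *)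
Lemma pair_torsion_free a gamma n :
  value_transcendental nu omega -> is_val_ag nubar a gamma omegabar ->
  gamma *+ n.+1 \notin value_group nubar.
Proof.
move=> [_ dim1] w_ag; apply/negP => /value_group_div_closed /value_groupP[b vb].
suff /rational_dim_torsion/(_ dim1) : forall m : value_quotient omega nu,
  exists k, m *+ k.+1 = 0 by [].
elim/quotW => -[g gw]; have /value_groupP[f wf] := gw.
have [p [q [q0 fpq]]] := tofrac_div f.
have [zp wp] := val_ag_value_group w_ag vb (map_poly iota p).
have [zq wq] := val_ag_value_group w_ag vb (map_poly iota q).
have [hq vq] : exists h, omega q%:F = fin h.
  by apply: val_fin; rewrite tofrac_eq0.
have [hp vp] : exists h, omega p%:F = fin h.
  apply: val_fin; apply/eqP => p0; move: wf.
  by rewrite fpq p0 mul0r val0.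
have := val_div vp vq; rewrite -fpq wf => -[E].
rewrite extends_ratfun_poly wp in vp; rewrite extends_ratfun_poly wq in vq.
(* [zp] and [zq] in Kbar have the values of p and q, so g is the value of zp / zq, which is
   algebraic over K. *)
have [k gk] :=
  algebraic_val_torsion nubar_nu (Kbar_algebraic _) (val_div vp vq).
exists k; pose x : value_groupType omega := ValueGroup gw.
pose pi : {additive value_groupType omega -> value_quotient omega nu} :=
  \pi_(value_quotient omega nu)%qT.
rewrite -[_ *+ _](raddfMn pi k.+1 x) -(raddf0 pi).
apply/eqP; rewrite /pi -Quotient.idealrBE subr0.
change (\val (x *+ k.+1) \in value_group nu).
by rewrite raddfMn /= E.
Qed.

End AlgebraicClosure.

(** * Values of Q, of polynomials of lower degree, and of Q-expansions *)

Theorem lemma3p2 (K : fieldType) (Kbar : closedFieldType)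
    (iota : {rmorphism K -> Kbar})
    (Kbar_algebraic : forall z : Kbar, algebraicOver iota z)
    (G : oagType)
    (nu : valuation K G) (nubar : valuation Kbar G)
    (omega : valuation {fraction {poly K}} G)
    (omegabar : valuation {fraction {poly Kbar}} G)
    (nubar_nu : extends iota nu nubar)
    (omega_nu : value_transcendental nu omega)
    (omegabar_nubar : extends_to_ratfun nubar omegabar)
    (omegabar_omega : extends_ratfun iota omega omegabar)
    (a : Kbar) (gamma : G)
    (a_gamma : minimal_pair_of_definition iota nubar omegabar a gamma)
    (Q : {poly K}) (Q_min : is_minpoly iota a Q) :
  [/\ exists2 q : G, omega Q%:F = fin q & q \notin value_group nubar,
      forall g : {poly K}, (size g < size Q)%N ->
        omega g%:F = nubar (map_poly iota g).[a]
    & forall (f : {poly K}) (r : nat) (f_ : 'I_r.+1 -> {poly K}),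
        (forall i, (size (f_ i) < size Q)%N) ->
        f = \sum_(i < r.+1) f_ i * Q ^+ i ->
        omega f%:F =
          \big[Num.min/'oo]_(i < r.+1)
            (nubar (map_poly iota (f_ i)).[a] + omega Q%:F *+ i)].
Proof.
have [[_ w_ag] a_minimal] := a_gamma.
have gamma_tf n := pair_torsion_free Kbar_algebraic nubar_nu
  omegabar_omega n omega_nu w_ag.
have ltQ (g : {poly K}) :
    (size g < size Q)%N -> omega g%:F = nubar (map_poly iota g).[a].
  move=> ltgQ; have [->|g0] := eqVneq g 0.
    by rewrite tofrac0 rmorph0 horner0 !val0.
  rewrite (extends_ratfun_poly omegabar_omega).
  apply: val_ag_eval omegabar_nubar w_ag _ => b gb; rewrite ltNge; apply/negP.
  move=> /a_minimal le_deg.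
  (* Minimality of the pair would give deg Q <= deg P, whereas g(b) = 0 gives deg P <= deg g < deg
     Q. *)
  have [P P_min] := is_minpoly_exists (Kbar_algebraic b).
  have := le_deg _ _ (adjoin_deg_minpoly Q_min) (adjoin_deg_minpoly P_min).
  have [Pmonic _ /(_ g g0 gb) lePg] := P_min.
  have : (0 < size P)%N by rewrite size_poly_gt0 monic_neq0.
  move: (leq_ltn_trans lePg ltgQ).
  by case: (size P) (size Q) => [|m] [|n] //=; rewrite ltnS ltnNge => /negP.
(* All positive multiples are excluded, not only q itself, because the terms of a Q-expansion are
   compared through differences of exponents. *)
have [q wQ q_tf] : exists2 q, omega Q%:F = fin q &
    forall n, q *+ n.+1 \notin value_group nubar.
  have [Qmonic Qa _] := Q_min.
  have [s Qs] := closed_field_poly_normal (map_poly iota Q).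
  rewrite (monicP _) ?map_monic // scale1r in Qs.
  have [k [h [hv sk ws]]] := val_ag_monic_split w_ag s.
  have {sk} k0 : (0 < k)%N by apply: sk; rewrite -root_prod_XsubC -Qs.
  exists (h + gamma *+ k).
    by rewrite (extends_ratfun_poly omegabar_omega) Qs.
  (* The multiple of h lies in nubar Kbar and drops out; k (n+1) is put in successor form to apply
     [gamma_tf]. *)
  move=> n; rewrite mulrnDl -mulrnA -(prednK k0) mulSn addSn.
  by rewrite rpredDl; [exact: gamma_tf|exact: rpredMn].
split=> //; first by exists q; rewrite // -(mulr1n q) q_tf.
move=> f r f_ ltf ->; rewrite rmorph_sum.
have wF i : omega (f_ i * Q ^+ i)%:F =
    nubar (map_poly iota (f_ i)).[a] + omega Q%:F *+ i.
  by rewrite tofracM tofracXn valM valX ltQ ?ltf.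
(* Coefficients contribute values of elements of Kbar, so by [q_tf] two terms can tie only at
   infinity. *)
rewrite val_sum_min => [|i j ij]; first by apply: eq_bigr => i _; rewrite wF.
by rewrite !wF wQ; apply: torsion_free_distinct.
Qed.
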